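(* An angle $\alpha$ is non-trisectable whenever $\cos(\alpha)$ is transcendental. Therefore the set $Tri$ of trisection numbers is countable, and the set of non-trisectable angles (as a subset of the unit circle $S^1$) is uncountable.
   Context: Let $S\subseteq\mathbb{R}^2$ contain $(0,0)$ and $(1,0)$. A point is constructible over $S$ if it can be obtained from points of $S$ by a finite sequence of straightedge-and-compass steps: (1) given two distinct points already available, one may draw the line through them, or the circle centered at one of them and passing through the other; (2) given two lines, two circles, or a line and a circle already drawn, one may add their intersection points. $C(S)$ denotes the set of all points constructible over $S$. An angle $\alpha$ (in radians) is identified with the point $(\cos\alpha,\sin\alpha)$ of the unit circle $S^1$. $\alpha$ is trisectable if $(\cos(\alpha/3),\sin(\alpha/3))\in C(\{(0,0),(1,0),(\cos\alpha,\sin\alpha)\})$ (this depends only on $\alpha$ modulo $2\pi$), and non-trisectable otherwise. A trisection number is a real number of the form $2\cos\alpha$ with $\alpha$ trisectable; $Tri$ is the set of all trisection numbers. *)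

(* Defs.v *)
From mathcomp Require Import all_boot all_order all_algebra all_field.
From mathcomp Require Import all_classical all_reals all_analysis.

Set Implicit Arguments.
Unset Strict Implicit.
Unset Printing Implicit Defensive.

Import Order.TTheory GRing.Theory Num.Theory.

Local Open Scope classical_set_scope.
Local Open Scope ring_scope.

Definition line_through (R : realType) (P Q : R * R) : set (R * R) :=
  [set X | (X.1 - P.1) * (Q.2 - P.2) = (X.2 - P.2) * (Q.1 - P.1)].

Definition circle_through (R : realType) (O P : R * R) : set (R * R) :=
  [set X | (X.1 - O.1) ^+ 2 + (X.2 - O.2) ^+ 2
           = (P.1 - O.1) ^+ 2 + (P.2 - O.2) ^+ 2].

(* A derivation tree of [constructible S P], read from the leaves to the root,
   is a finite sequence of straightedge-and-compass steps, and conversely.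
   Lines and circles are plain sets of points, so [A <> B] says that the two
   curves really differ: a curve has no intersection points with itself, even
   when it is drawn from two different pairs of points. *)
Inductive constructible (R : realType) (S : set (R * R)) : R * R -> Prop :=
| constructible_given (P : R * R) : S P -> constructible S P
| constructible_meet (A B : set (R * R)) (P : R * R) :
    drawn S A -> drawn S B -> A <> B -> A P -> B P -> constructible S P
with drawn (R : realType) (S : set (R * R)) : set (R * R) -> Prop :=
| drawn_line (P Q : R * R) :
    constructible S P -> constructible S Q -> P <> Q ->
    drawn S (line_through P Q)
| drawn_circle (O P : R * R) :
    constructible S O -> constructible S P -> O <> P ->
    drawn S (circle_through O P).

Definition angle_point (R : realType) (a : R) : R * R := (cos a, sin a).

Definition trisectable (R : realType) (a : R) : Prop :=
  constructible [set (0 : R, 0 : R); (1 : R, 0 : R); angle_point a]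
    (angle_point (a / 3)).

Definition Tri (R : realType) : set R :=
  [set 2 * cos a | a in [set a : R | trisectable a]].
Arguments Tri R : clear implicits.

Definition non_trisectable_angles (R : realType) : set (R * R) :=
  [set angle_point a | a in [set a : R | ~ trisectable a]].
Arguments non_trisectable_angles R : clear implicits.

Definition transcendental (R : realType) (x : R) : Prop :=
  ~ algebraicOver (ratr : rat -> R) x.

(* Main.v *)
(* If [t = cos a] is transcendental, then [4 x^3 - 3 x = t] has no root in Q(t):
   clearing denominators gives a polynomial identity with incompatible degrees.
   By Zorn there is a maximal subfield [M] of R which contains Q(t) and no root
   of this cubic. Adjoining a square root to a field creates no root of a cubic
   that had none, so maximality makes [M] closed under square roots. Hence the
   coordinates of all points constructible from (0,0), (1,0), (cos a, sin a) lie
   in [M], whereas [cos (a / 3)] is a root. The cardinality statements follow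
   because there are only countably many algebraic numbers. *)
Require Import Defs.
From mathcomp Require Import all_boot all_order all_algebra all_field.
From mathcomp Require Import all_classical all_reals all_analysis.
From mathcomp Require Import ring lra zify.

Set Implicit Arguments.
Unset Strict Implicit.
Unset Printing Implicit Defensive.

Import Order.TTheory GRing.Theory Num.Theory.

Local Open Scope classical_set_scope.
Local Open Scope ring_scope.

(** * Subfields as sets, and maximal ones avoiding a given set *)

Record subfield (F : fieldType) (K : set F) : Prop := Subfield {
  subfield1 : K 1;
  subfieldB : forall x y, K x -> K y -> K (x - y);
  subfield_div : forall x y, K x -> K y -> K (x / y) }.

Section Subfield.
Variables (F : fieldType) (K : set F).
Hypothesis HK : subfield K.

Lemma subfield0 : K 0.
Proof. by rewrite -(subrr 1); apply: (subfieldB HK) => //; apply: (subfield1 HK). Qed.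

Lemma subfieldN x : K x -> K (- x).
Proof. by move=> Kx; rewrite -sub0r; apply: (subfieldB HK) => //; apply: subfield0. Qed.

Lemma subfieldD x y : K x -> K y -> K (x + y).
Proof.
by move=> Kx Ky; rewrite -[y]opprK; apply: (subfieldB HK) => //; apply: subfieldN.
Qed.

Lemma subfieldV x : K x -> K x^-1.
Proof.
by move=> Kx; rewrite -div1r; apply: (subfield_div HK) => //; apply: (subfield1 HK).
Qed.

Lemma subfieldM x y : K x -> K y -> K (x * y).
Proof.
by move=> Kx Ky; rewrite -[y]invrK; apply: (subfield_div HK) => //; apply: subfieldV.
Qed.

Lemma subfield_nat n : K n%:R.
Proof.
elim: n => [|n IH]; first exact: subfield0.
by rewrite -addn1 natrD; apply: subfieldD => //; apply: (subfield1 HK).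
Qed.

Lemma subfieldX x n : K x -> K (x ^+ n).
Proof.
move=> Kx; elim: n => [|n IH]; first by rewrite expr0; apply: (subfield1 HK).
by rewrite exprS; apply: subfieldM.
Qed.

End Subfield.

Ltac in_subfield :=
  repeat first
    [ assumption
    | match goal with
      | |- _ (_%:R) => apply: subfield_nat
      | |- _ 0 => apply: subfield0
      | |- _ 1 => apply: subfield1
      | |- _ (_ + _) => apply: subfieldD
      | |- _ (- _) => apply: subfieldN
      | |- _ (_ * _) => apply: subfieldM
      | |- _ (_^-1) => apply: subfieldV
      | |- _ (_ ^+ _) => apply: subfieldX
      end ].

Lemma maximal_subfield (F : fieldType) (K Z : set F) :
  subfield K -> K `<=` ~` Z ->
  exists M, [/\ subfield M, K `<=` M, M `<=` ~` Z &
    forall L, subfield L -> M `<=` L -> L `<=` ~` Z -> L `<=` M].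
Proof.
move=> HK KZ.
pose good M := [/\ subfield M, K `<=` M & M `<=` ~` Z].
(* The empty chain has union [set0], so the property given to Zorn's lemma must admit [set0]. *)
have [|M [M0 Mmax]] := @Zorn_bigcup F (fun M => M = set0 \/ good M).
  move=> C CP Ctot.
  have [[X [CX gX]]|nogood] := pselect (exists X, C X /\ good X); last first.
    left; apply/seteqP; split=> // x [X CX Xx].
    case: (CP X CX) => [X0|gX]; first by rewrite -X0.
    by exfalso; apply: nogood; exists X.
  right.
  (* Two elements of the union lie in one member of the chain, so closure under an operation can be
     checked there. *)
  have pair x y : (\bigcup_(X in C) X) x -> (\bigcup_(X in C) X) y ->
      exists Y, [/\ C Y, good Y, Y x & Y y].
    move=> [U CU Ux] [V CV Vy].
    have goodP Y z : C Y -> Y z -> good Y.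
      by move=> CY Yz; case: (CP Y CY) => // Y0; move: Yz; rewrite Y0.
    case: (Ctot U V CU CV) => [UV|VU].
      by exists V; split => //; [exact: goodP Vy|exact: UV].
    by exists U; split => //; [exact: goodP Ux|exact: VU].
  split.
  + split; first by exists X => //; apply: subfield1; case: gX.
    * move=> x y Cx Cy; have [Y [CY [HY _ _] Yx Yy]] := pair x y Cx Cy.
      by exists Y => //; apply: subfieldB.
    * move=> x y Cx Cy; have [Y [CY [HY _ _] Yx Yy]] := pair x y Cx Cy.
      by exists Y => //; apply: subfield_div.
  + by move=> x Kx; exists X => //; case: gX => _ + _; apply.
  + move=> x Cx; have [Y [_ [_ _ YZ] Yx _]] := pair x x Cx Cx.
    exact: YZ.
have gK : good K by split.
(* The maximal set is not [set0], since [K] is good and strictly larger. *)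
have [HM KM MZ] : good M.
  case: M0 => // M0; exfalso; apply: (Mmax K); last by right.
  rewrite M0; split=> // /(_ 1); apply; exact: subfield1.
exists M; split=> // L HL ML LZ; apply: contrapT => LM.
by apply: (Mmax L); [split|right; split=> //; apply: subset_trans ML].
Qed.

(** * Adjoining a square root *)

Section QuadraticExtension.
Variables (F : fieldType) (K : set F) (s : F).
Hypotheses (HK : subfield K) (Ks2 : K (s ^+ 2)) (Ks : ~ K s).

Definition adjoin_sqrt : set F :=
  [set z | exists a b, [/\ K a, K b & z = a + b * s]].

Lemma sub_adjoin_sqrt : K `<=` adjoin_sqrt.
Proof. by move=> x Kx; exists x, 0; split => //; [in_subfield|ring]. Qed.

Lemma adjoin_sqrt_gen : adjoin_sqrt s.
Proof. by exists 0, 1; split; [in_subfield|in_subfield|ring]. Qed.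

Lemma adjoin_sqrt_eq0 a b : K a -> K b -> a + b * s = 0 -> a = 0 /\ b = 0.
Proof.
move=> Ka Kb abs0; have b0 : b = 0.
  have [//|b0] := eqVneq b 0; exfalso; apply: Ks.
  have -> : s = - a / b.
    by apply: (canRL (mulfK b0)); apply/eqP; rewrite -addr_eq0 mulrC addrC abs0.
  by in_subfield.
by move: abs0; rewrite b0 mul0r addr0.
Qed.

Lemma subfield_adjoin_sqrt : subfield adjoin_sqrt.
Proof.
split; first exact/sub_adjoin_sqrt/(subfield1 HK).
- move=> _ _ [a [b [Ka Kb ->]]] [c [d [Kc Kd ->]]].
  by exists (a - c), (b - d); split; [in_subfield|in_subfield|ring].
- move=> _ _ [a [b [Ka Kb ->]]] [c [d [Kc Kd ->]]].
  have [cd0|cd0] := eqVneq (c + d * s) 0.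
    by rewrite cd0 invr0 mulr0; apply/sub_adjoin_sqrt/(subfield0 HK).
  (* A vanishing conjugate forces [c = d = 0]; hence the norm is nonzero and division can be
     rationalised. *)
  have cd0' : c - d * s != 0.
    apply: contraNneq cd0; rewrite -mulNr => /adjoin_sqrt_eq0[||-> /eqP] //.
      by in_subfield.
    by rewrite oppr_eq0 => /eqP ->; rewrite mul0r addr0.
  have N0 : c ^+ 2 - d ^+ 2 * s ^+ 2 != 0.
    by rewrite -exprMn subr_sqr mulf_neq0.
  exists ((a * c - b * d * s ^+ 2) / (c ^+ 2 - d ^+ 2 * s ^+ 2)).
  exists ((b * c - a * d) / (c ^+ 2 - d ^+ 2 * s ^+ 2)).
  split; [by in_subfield|by in_subfield|].
  by field; rewrite exprMn N0 cd0.
Qed.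

(* If [a + b s] is a root and [b <> 0], then so is its conjugate [a - b s];
   the cubic has no quadratic term, hence its third root is [- 2 a]. *)
Lemma trisection_root_descent t x : K t ->
  adjoin_sqrt x -> 4 * x ^+ 3 - 3 * x = t ->
  exists2 y, K y & 4 * y ^+ 3 - 3 * y = t.
Proof.
move=> Kt [a [b [Ka Kb ->]]] ht.
have [b0|b0] := eqVneq b 0.
  by exists a => //; rewrite -ht b0; ring.
have /adjoin_sqrt_eq0[||re /eqP im] :
  (4 * a ^+ 3 + 12 * a * b ^+ 2 * s ^+ 2 - 3 * a - t)
  + (b * (12 * a ^+ 2 + 4 * b ^+ 2 * s ^+ 2 - 3)) * s = 0.
- by rewrite -ht; ring.
- by in_subfield.
- by in_subfield.
exists (- (2 * a)); first by in_subfield.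
move: im; rewrite mulf_eq0 (negPf b0) /= => /eqP im.
(* Both added terms vanish; the factor [- 3 * a] is chosen to cancel [s ^+ 2], leaving the value of
   the cubic at [- 2 a]. *)
have -> : t = t + (4 * a ^+ 3 + 12 * a * b ^+ 2 * s ^+ 2 - 3 * a - t)
            - 3 * a * (12 * a ^+ 2 + 4 * b ^+ 2 * s ^+ 2 - 3) by rewrite re im; ring.
by ring.
Qed.

End QuadraticExtension.

(** * Countability of algebraic numbers, and the triple-angle formula *)

Lemma finite_roots (F : idomainType) (p : {poly F}) :
  p != 0 -> finite_set [set x | root p x].
Proof.
move=> p0; apply: contrapT => /(infinite_set_fset (size p))[B Bp].
rewrite leqNgt => /negP; apply; apply: max_poly_roots => //; first exact/allP.
exact: finmap.fset_uniq.
Qed.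

Lemma countable_algebraic (R : numFieldType) :
  countable [set x : R | algebraicOver (ratr : rat -> R) x].
Proof.
apply: (@sub_countable _ _ _ (\bigcup_(p in [set p : {poly rat} | p != 0])
    [set x : R | root (map_poly ratr p) x])).
  by apply: subset_card_le => x [p p0 rx]; exists p.
apply: bigcup_countable => [|p /= p0]; first exact: countableP.
by apply/finite_set_countable/finite_roots; rewrite map_poly_eq0.
Qed.

(** A countable set has Lebesgue measure 0, while this interval has measure 2. *)
Lemma uncountable_itvN11 (R : realType) : ~ countable `[(-1 : R), 1].
Proof.
move=> /countable_lebesgue_measure0; rewrite lebesgue_measure_itv /= lte_fin.
by rewrite ifT; [rewrite -EFinB => -[]; lra | lra].
Qed.

Lemma cos3 (R : realType) (x : R) : cos x = 4 * cos (x / 3) ^+ 3 - 3 * cos (x / 3).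
Proof.
have {1}-> : x = x / 3 + x / 3 + x / 3 by field.
rewrite !cosD !sinD; have := sin2cos2 (x / 3).
move: (cos _) (sin _) => c s /(congr1 (fun u => c * u)) H.
suff : c * (c ^+ 2 - 3 * s ^+ 2) = 4 * c ^+ 3 - 3 * c by move=> <-; ring.
have -> : c * (c ^+ 2 - 3 * s ^+ 2) = c ^+ 3 - 3 * (c * s ^+ 2) by ring.
by rewrite H; ring.
Qed.

(** * The field generated by a transcendental element *)

Section RationalFunctions.
Variables (F E : fieldType) (f : {rmorphism F -> E}) (t : E).

Local Notation ev p := (map_poly f p).[t].

(** This is $F(t)$ inside [E]; a quotient whose denominator vanishes at [t] has value 0, as
    [0^-1 = 0]. *)
Definition rational_values : set E := [set x | exists p q, x = ev p / ev q].

Lemma subfield_rational_values : subfield rational_values.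
Proof.
split; first by exists 1, 1; rewrite rmorph1 hornerC divr1.
- move=> _ _ [p [q ->]] [r [s ->]].
  have [q0|q0] := eqVneq (ev q) 0.
    by exists (- r), s; rewrite q0 invr0 mulr0 sub0r rmorphN hornerN mulNr.
  have [s0|s0] := eqVneq (ev s) 0.
    by exists p, q; rewrite s0 invr0 mulr0 subr0.
  exists (p * s - r * q), (q * s).
  by rewrite rmorphB !rmorphM hornerD hornerN !hornerM; field; rewrite q0 s0.
- move=> _ _ [p [q ->]] [r [s ->]].
  by exists (p * s), (q * r); rewrite !rmorphM !hornerM invf_div mulf_div.
Qed.

Lemma rational_values_gen : rational_values t.
Proof. by exists 'X, 1; rewrite rmorph1 map_polyX hornerX hornerC divr1. Qed.

Hypothesis t_transc : ~ algebraicOver f t.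

Lemma transcendental_horner_eq0 p : ev p = 0 -> p = 0.
Proof.
move=> p0; have [//|pN0] := eqVneq p 0.
by case: t_transc; exists p => //; apply/eqP.
Qed.

(* Clearing denominators gives the polynomial identity
   [4 p^3 - 3 p q^2 = X q^3], which no pair of degrees can satisfy. *)
Lemma trisection_rootless x : (4 : F) != 0 -> rational_values x ->
  4 * x ^+ 3 - 3 * x <> t.
Proof.
move=> four0 [p [q xE]] ht.
have t0 : t != 0.
  apply/eqP => t0; case: t_transc; exists 'X; first by rewrite polyX_eq0.
  by rewrite map_polyX t0 rootX.
(* A zero denominator would give [x = 0], hence [t = 0]. *)
have q0 : ev q != 0.
  apply: contra_neq t0 => q0.
  by rewrite -ht xE q0 invr0 mulr0 expr0n /= !mulr0 subr0.
have qN0 : q != 0 by apply: contraNneq q0 => ->; rewrite rmorph0 horner0.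
have id : p ^+ 3 *+ 4 = 'X * q ^+ 3 + p * q ^+ 2 *+ 3.
  apply/eqP; rewrite -subr_eq0; apply/eqP/transcendental_horner_eq0.
  rewrite rmorphB rmorphMn rmorphXn rmorphD rmorphMn rmorphM rmorphXn.
  rewrite rmorphM rmorphXn /= map_polyX.
  rewrite hornerD hornerN hornerMn horner_exp hornerD hornerMn.
  rewrite hornerM hornerX horner_exp hornerM horner_exp; move: xE q0.
  by move: (ev p) (ev q) => P Q xE q0; rewrite -ht xE; field.
have size_expE (r : {poly F}) n : r != 0 -> size (r ^+ n) = (n * (size r).-1).+1.
  by move=> r0; rewrite mulnC -size_exp prednK // size_poly_gt0 expf_neq0.
have sX : size ('X * q ^+ 3) = (3 * (size q).-1).+2.
  by rewrite size_mul ?polyX_eq0 ?expf_neq0 // size_polyX size_expE //; lia.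
have p0 : p != 0.
  apply: contra_neq t0 => p0.
  by rewrite -ht xE p0 rmorph0 horner0 mul0r expr0n /= !mulr0 subr0.
have s4 : size (p ^+ 3 *+ 4) = (3 * (size p).-1).+1.
  by rewrite -mulr_natl -polyC_natr size_Cmul // size_expE //; lia.
(* Only an upper bound, since 3 may vanish in [F]; for [s4] the hypothesis [four0] gives the exact
   size. *)
have s3 : (size (p * q ^+ 2 *+ 3)%R <= (size p).-1 + (2 * (size q).-1).+1)%N.
  rewrite -scaler_nat; apply: leq_trans (size_scale_leq _ _) _.
  apply: leq_trans (size_polyMleq _ _) _; rewrite size_expE //.
  by have : (0 < size p)%N; [rewrite size_poly_gt0|lia].
(* If $\deg p \le \deg q$, the term $X q^3$ has strictly the largest degree; otherwise $4 p^3$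
   has. *)
have [pq|qp] := leqP (size p) (size q).
  have : (size ('X * q ^+ 3)%R <= (3 * (size q).-1).+1)%N.
    rewrite -['X * _](addrK (p * q ^+ 2 *+ 3)) -id.
    apply: leq_trans (size_polyD _ _) _; rewrite size_polyN geq_max s4.
    by rewrite (leq_trans s3); lia.
  by rewrite sX; lia.
have : (size (p ^+ 3 *+ 4)%R <= 3 * (size p).-1)%N.
  rewrite id; apply: leq_trans (size_polyD _ _) _; rewrite geq_max sX.
  have : (0 < size q)%N by rewrite size_poly_gt0.
  by move=> ?; rewrite (leq_trans s3); lia.
by rewrite s4; lia.
Qed.

End RationalFunctions.

(** * Quadratic equations over a field closed under square roots *)

Section SqrtClosed.
Variables (F : fieldType) (K : set F).
Hypotheses (HK : subfield K) (two0 : (2 : F) != 0).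
Hypothesis Ksqrt : forall s, K (s ^+ 2) -> K s.

(** Completing the square: [2 * a * x + b] is a square root of the discriminant. *)
Lemma quadratic_root a b c x : K a -> K b -> K c -> a != 0 ->
  a * x ^+ 2 + b * x + c = 0 -> K x.
Proof.
move=> Ka Kb Kc a0 H.
have disc : (2 * a * x + b) ^+ 2 = b ^+ 2 - 4 * a * c.
  have -> : c = - (a * x ^+ 2 + b * x) by apply/eqP; rewrite -addr_eq0 addrC H.
  by ring.
have -> : x = (2 * a * x + b - b) / (2 * a).
  by field; rewrite two0 a0.
have : K (2 * a * x + b) by apply: Ksqrt; rewrite disc; in_subfield.
by move=> ?; in_subfield.
Qed.

End SqrtClosed.

(* Lines, circles and their intersections over such a field *)
Scheme constructible_drawn_ind := Minimality for constructible Sort Prop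
  with drawn_constructible_ind := Minimality for drawn Sort Prop.

Section Curves.
Variables (R : realType) (K : set R).
Hypothesis HK : subfield K.
Hypothesis Ksqrt : forall s, K (s ^+ 2) -> K s.

(* The zero sets of [a (x^2 + y^2) + b x + c y + e] treat lines ([a = 0]) and
   circles ([a = 1]) uniformly. *)
Definition curve (a b c e : R) : set (R * R) :=
  [set X | a * (X.1 ^+ 2 + X.2 ^+ 2) + b * X.1 + c * X.2 + e = 0].

Lemma line_throughE (P Q : R * R) :
  line_through P Q = curve 0 (Q.2 - P.2) (P.1 - Q.1) (P.2 * Q.1 - P.1 * Q.2).
Proof. by apply/seteqP; split=> X; rewrite /line_through /curve /= => H; lra. Qed.

Lemma circle_throughE (O P : R * R) :
  circle_through O P = curve 1 (- 2 * O.1) (- 2 * O.2)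
    (O.1 ^+ 2 + O.2 ^+ 2 - (P.1 - O.1) ^+ 2 - (P.2 - O.2) ^+ 2).
Proof. by apply/seteqP; split=> X; rewrite /circle_through /curve /= => H; lra. Qed.

Definition line_over (A : set (R * R)) := exists b c e,
  [/\ K b, K c, K e, b != 0 \/ c != 0 & A = curve 0 b c e].

Definition circle_over (A : set (R * R)) := exists b c e,
  [/\ K b, K c, K e & A = curve 1 b c e].

Definition point_over (X : R * R) := K X.1 /\ K X.2.

Lemma curve0_swap b c e x y : curve 0 b c e (x, y) <-> curve 0 c b e (y, x).
Proof. by rewrite /curve /=; split=> H; lra. Qed.

Lemma curve1_swap b c e x y : curve 1 b c e (x, y) <-> curve 1 c b e (y, x).
Proof. by rewrite /curve /=; split=> H; lra. Qed.

(** Proportional normal vectors have the same orthogonal directions; one multiplies by whichever of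
    [b], [c] is nonzero. *)
Lemma parallel_direction (b c b' c' : R) : b != 0 \/ c != 0 -> forall u v,
  b' * c = b * c' -> b * u + c * v = 0 -> b' * u + c' * v = 0.
Proof.
move=> bc0 u v D0 uv0.
have Eb : b * (b' * u + c' * v) = 0.
  by rewrite mulrDr !mulrA -D0 [b * b']mulrC -!mulrA -mulrDr uv0 mulr0.
have Ec : c * (b' * u + c' * v) = 0.
  rewrite mulrDr !mulrA [c * b']mulrC D0 [b * c']mulrC [c * c']mulrC.
  by rewrite -!mulrA -mulrDr uv0 mulr0.
by case: bc0 => /mulfI inj; apply: inj; rewrite ?Eb ?Ec mulr0.
Qed.

Lemma meet_line_line A B X : line_over A -> line_over B -> A <> B ->
  A X -> B X -> point_over X.
Proof.
move=> [b [c [e [Kb Kc Ke bc0 ->]]]] [b' [c' [e' [Kb' Kc' Ke' bc0' ->]]]] AB.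
rewrite /curve /= => HA HB.
(* With zero determinant the lines are parallel and share [X], so they coincide; otherwise Cramer's
   rule applies. *)
have [D0|D0] := eqVneq (b * c') (b' * c).
  exfalso; apply: AB; apply/seteqP; split=> Y; rewrite /curve /= => HY.
    suff : b' * (Y.1 - X.1) + c' * (Y.2 - X.2) = 0 by lra.
    by apply: (parallel_direction bc0); lra.
  suff : b * (Y.1 - X.1) + c * (Y.2 - X.2) = 0 by lra.
  by apply: (parallel_direction bc0'); lra.
split.
- have -> : X.1 = (e' * c - e * c') / (b * c' - b' * c).
    apply: (canRL (mulfK _)); first by rewrite subr_eq0.
    have -> : e' = - (b' * X.1 + c' * X.2) by lra.
    have -> : e = - (b * X.1 + c * X.2) by lra.
    by ring.
  by in_subfield.
- have -> : X.2 = (b' * e - b * e') / (b * c' - b' * c).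
    apply: (canRL (mulfK _)); first by rewrite subr_eq0.
    have -> : e' = - (b' * X.1 + c' * X.2) by lra.
    have -> : e = - (b * X.1 + c * X.2) by lra.
    by ring.
  by in_subfield.
Qed.

Lemma meet_line_circle A B X : line_over A -> circle_over B ->
  A X -> B X -> point_over X.
Proof.
move=> [b [c [e [Kb Kc Ke bc0 ->]]]] [b' [c' [e' [Kb' Kc' Ke' ->]]]].
case: X => x y.
have two0 : (2 : R) != 0 by rewrite pnatr_eq0.
(* Exchanging the coordinates reduces to a line that can be solved for [x]. *)
wlog b0 : b c b' c' x y Kb Kc Kb' Kc' bc0 / b != 0.
  move=> W; have [b0|c0] := bc0; first exact: (W b c b' c').
  move=> /curve0_swap HA /curve1_swap HB.
  by have [] := W c b c' b' y x Kc Kb Kc' Kb' (or_introl c0) c0 HA HB.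
rewrite /curve /= => HA HB.
have xE : x = - (c * y + e) / b.
  by apply: (canRL (mulfK b0)); lra.
have Ky : K y.
  (* Coefficients of the circle equation after substituting [x = - (c * y + e) / b] and multiplying
     by [b ^+ 2]. *)
  apply: (@quadratic_root _ _ HK two0 Ksqrt (b ^+ 2 + c ^+ 2)
    (2 * c * e - b * b' * c + b ^+ 2 * c') (e ^+ 2 - b * b' * e + b ^+ 2 * e')).
  - by in_subfield.
  - by in_subfield.
  - by in_subfield.
  - by rewrite paddr_eq0 ?sqr_ge0 // sqrf_eq0 (negPf b0).
  - have -> : e' = - (x ^+ 2 + y ^+ 2 + b' * x + c' * y) by lra.
    by rewrite xE; field.
by split => //=; rewrite xE; in_subfield.
Qed.

(** Subtracting the equations gives the radical axis, a line over [K] through the common points. *)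
Lemma meet_circle_circle A B X : circle_over A -> circle_over B -> A <> B ->
  A X -> B X -> point_over X.
Proof.
move=> cA cB; have [b [c [e [Kb Kc Ke AE]]]] := cA.
have [b' [c' [e' [Kb' Kc' Ke' BE]]]] := cB => AB AX BX.
apply: (meet_line_circle (A := curve 0 (b - b') (c - c') (e - e')) _ cA) => //.
- exists (b - b'), (c - c'), (e - e'); split=> //; try by in_subfield.
  (* Concentric circles with a common point coincide, so the axis is a genuine line. *)
  apply/orP; rewrite -negb_and; apply/negP => /andP[/eqP bb /eqP cc]; apply: AB.
  move: AX BX; rewrite AE BE /curve /= => HA HB.
  have bE : b = b' by lra.
  have cE : c = c' by lra.
  suff -> : e = e' by rewrite bE cE.
  by rewrite bE cE in HA; lra.
- by move: AX BX; rewrite AE BE /curve /= => HA HB; lra.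
Qed.

Lemma drawn_meet A B X : line_over A \/ circle_over A ->
  line_over B \/ circle_over B -> A <> B -> A X -> B X -> point_over X.
Proof.
move=> [lA|cA] [lB|cB] AB AX BX.
- exact: (meet_line_line lA lB).
- exact: (meet_line_circle lA cB).
- exact: (meet_line_circle lB cA).
- exact: (meet_circle_circle cA cB).
Qed.

Lemma line_over_through P Q : point_over P -> point_over Q -> P <> Q ->
  line_over (line_through P Q).
Proof.
case: P Q => [p1 p2] [q1 q2] [/= K1 K2] [/= K3 K4] PQ.
rewrite line_throughE /=; exists (q2 - p2), (p1 - q1), (p2 * q1 - p1 * q2).
split=> //; try by in_subfield.
apply/orP; rewrite -negb_and !subr_eq0; apply/negP => /andP[/eqP E2 /eqP E1].
by apply: PQ; rewrite E1 E2.
Qed.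

Lemma circle_over_through P Q : point_over P -> point_over Q ->
  circle_over (circle_through P Q).
Proof.
case: P Q => [p1 p2] [q1 q2] [/= K1 K2] [/= K3 K4].
rewrite circle_throughE /=; do 3 eexists; split; last by reflexivity.
all: by in_subfield.
Qed.

Lemma constructible_over S X : S `<=` point_over ->
  constructible S X -> point_over X.
Proof.
(* Joint induction: points have coordinates in [K], drawn curves have equations over [K]. *)
move=> SK; apply: (constructible_drawn_ind (S := S)
  (P0 := fun A => line_over A \/ circle_over A)) X =>
  [X /SK //||P Q _ KP _ KQ PQ|P Q _ KP _ KQ _].
- by move=> A B X _ KA _ KB AB AX BX; exact: (drawn_meet KA KB).
- by left; exact: line_over_through.
- by right; exact: circle_over_through.
Qed.

End Curves.

(** * Trisectability forces an algebraic cosine; the cardinality statements *)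

Lemma trisectable_algebraic (R : realType) (a : R) :
  trisectable a -> algebraicOver (ratr : rat -> R) (cos a).
Proof.
move=> tri; apply: contrapT => transc.
pose Z := [set x : R | 4 * x ^+ 3 - 3 * x = cos a].
have KZ : rational_values (ratr : {rmorphism rat -> R}) (cos a) `<=` ~` Z.
  by move=> x Kx; apply: (trisection_rootless transc) => //; rewrite pnatr_eq0.
have [M [HM KM MZ Mmax]] :=
  maximal_subfield (subfield_rational_values _ (cos a)) KZ.
have Mt : M (cos a) by apply: KM; exact: rational_values_gen.
have Msqrt s : M (s ^+ 2) -> M s.
  move=> Ms2; apply: contrapT => Ms.
  apply/Ms/(Mmax (adjoin_sqrt M s)).
  - exact: subfield_adjoin_sqrt.
  - exact: sub_adjoin_sqrt.
  - move=> x /(trisection_root_descent HM Ms2 Ms Mt) H /H [y My]; exact: MZ.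
  - exact: adjoin_sqrt_gen.
have Msin : M (sin a).
  by apply: Msqrt; rewrite sin2cos2; in_subfield.
have [|Mx _] := constructible_over HM Msqrt _ tri.
  by move=> _ [[->|->]|->]; split=> //=; in_subfield.
exact: (MZ _ Mx (esym (cos3 a))).
Qed.

Theorem corollary3p2 (R : realType) :
  (forall a : R, transcendental (cos a) -> ~ trisectable a) /\
  countable (Tri R) /\
  ~ countable (non_trisectable_angles R).
Proof.
split; first by move=> a ta /trisectable_algebraic.
have calg := countable_algebraic R.
split.
  apply: sub_countable calg.
  apply: card_le_trans (card_image_le (fun x : R => 2 * x) _).
  apply: subset_card_le => _ [a ta <-].
  by exists (cos a) => //; exact: trisectable_algebraic.
move=> cnt; apply: (@uncountable_itvN11 R).
(* Every point of $[-1,1]$ is algebraic or the abscissa of a non-trisectable angle, so this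
   two-member family covers the interval. *)
pose A (b : bool) : set R := if b then [set x | algebraicOver (ratr : rat -> R) x]
  else fst @` non_trisectable_angles R.
apply: (@sub_countable _ _ _ (\bigcup_(b in setT) A b)).
  apply: subset_card_le => x /acosK cosx.
  have [alg|transc] := pselect (algebraicOver (ratr : rat -> R) x).
    by exists true.
  exists false => //; exists (angle_point (acos x)) => //=.
  by exists (acos x) => //= /trisectable_algebraic; rewrite cosx.
apply: bigcup_countable => [|[] _] //=.
by apply: sub_countable cnt; exact: card_image_le.
Qed.
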